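(* Let $B$ be the $\mathbb Z$-infinite Pascal-Bratteli diagram. For a probability vector $\overline d=\langle d_i: i\in\mathbb Z\rangle$ (i.e. $d_i\ge0$, $\sum_{i\in\mathbb Z}d_i=1$), let $\mu_{\overline d}$ be the tail invariant probability measure on the path space $X_B$ whose value on the cylinder set of any finite path from $V_1$ to a vertex $\overline s=(\ldots,s_{-1},s_0,s_1,\ldots)\in V_n$ is $\prod_{i\in\mathbb Z}d_i^{s_i}$. Then the measures $\mu_{\overline d}$, where $\overline d$ runs over all probability vectors, form the set of all ergodic tail invariant probability measures on $X_B$.
   Context: The $\mathbb Z$-infinite Pascal-Bratteli diagram has levels $V_n=\{\overline s=(\ldots,s_{-1},s_0,s_1,\ldots): s_i\in\mathbb Z_{\ge0},\ \sum_{i\in\mathbb Z}s_i=n\}$, $n\in\mathbb N=\{1,2,\ldots\}$. There is exactly one edge between $\overline s\in V_n$ (source) and $\overline t\in V_{n+1}$ (range) if $\overline t=\overline s+\overline e^{(i)}$ for some $i\in\mathbb Z$, where $\overline e^{(i)}$ has its only nonzero entry, equal to $1$, at place $i$, and no edge otherwise. The path space $X_B$ is the set of infinite paths starting at $V_1$, equivalently sequences $(\overline s^{(1)},\overline s^{(2)},\ldots)$ with $\overline s^{(n)}\in V_n$ and consecutive vertices joined by an edge, with topology generated by cylinder sets (sets of all infinite paths with a prescribed finite initial path; a path of length $0$ is a vertex of $V_1$). Convention: $0^0=1$. Two infinite paths are tail equivalent if they coincide from some level on. A Borel measure on $X_B$ is tail invariant if it takes equal values on cylinder sets of finite paths (starting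 in $V_1$) with the same terminal vertex; a tail invariant probability measure is ergodic if every Borel set that is a union of tail equivalence classes has measure $0$ or $1$. *)

(* Defs.v *)
From HB Require Import structures.
From mathcomp Require Import all_boot all_order all_algebra.
From mathcomp Require Import finmap.
From mathcomp Require Import all_classical all_reals all_analysis.

Set Implicit Arguments.
Unset Strict Implicit.
Unset Printing Implicit Defensive.
Import Order.TTheory GRing.Theory Num.Theory.
Local Open Scope classical_set_scope.
Local Open Scope ring_scope.

(** * The Z-infinite Pascal-Bratteli diagram *)

(* A sequence of nonnegative integers indexed by Z whose entries have a finite
   sum is finitely supported. *)
Definition vertex := {fsfun int -> nat with 0%N}.

Definition V (n : nat) : set vertex :=
  [set s | (\sum_(i <- finsupp s) s i)%N = n].

Definition unit_vertex (i : int) : vertex := [fsfun [fsfun] with i |-> 1%N].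

(* The diagram has at most one edge between two vertices, so that paths are
   determined by the vertices they visit. *)
Definition edge (s t : vertex) : bool :=
  `[< exists i : int, forall j : int, t j = (s j + unit_vertex i j)%N >].

(** * The path space *)

(* Levels are numbered from 1: the k-th entry of a path lies in V k.+1. *)
Definition is_infinite_path (x : nat -> vertex) : Prop :=
  (forall k, V k.+1 (x k)) /\ (forall k, edge (x k) (x k.+1)).

Record path_space := PathSpace {
  path_vertex :> nat -> vertex ;
  path_spaceP : is_infinite_path path_vertex }.

HB.instance Definition _ := gen_eqMixin path_space.
HB.instance Definition _ := gen_choiceMixin path_space.

(* A finite path starting in V 1 is given by its first vertex v and the list p
   of the vertices that follow; its terminal vertex is [last v p]. *)
Definition is_finite_path (v : vertex) (p : seq vertex) : Prop :=
  V 1 v /\ path edge v p.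

Definition cylinder (v : vertex) (p : seq vertex) : set path_space :=
  [set x : path_space | forall k, (k <= size p)%N -> x k = nth v (v :: p) k].

HB.instance Definition _ := isSubBaseTopological.Build path_space
  [set A | exists v p, is_finite_path v p /\ A = cylinder v p] id.

(* [measurableType] is a structure on pointed types; the distinguished path
   only serves as a witness that the path space is inhabited. *)
Definition constant_path_vertex (k : nat) : vertex :=
  [fsfun [fsfun] with 0 |-> k.+1].

Lemma constant_pathP : is_infinite_path constant_path_vertex.
Proof.
split=> k.
  rewrite /V /= finsupp_with /= finsupp0 fsetU0 big_seq_fset1.
  by rewrite fsfun_with.
apply/asboolP; exists 0 => j; rewrite /unit_vertex !fsfun_withE.
by case: eqP => [_|_]; rewrite ?addn1 ?fsfunE.
Qed.

HB.instance Definition _ :=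
  isPointed.Build path_space (PathSpace constant_pathP).

Definition borel_path_space := g_sigma_algebraType (@open path_space).

(** * Tail invariance and ergodicity *)

Definition tail_equivalent (x y : path_space) : Prop :=
  exists N, forall n, (N <= n)%N -> x n = y n.

Definition tail_class (x : path_space) : set path_space :=
  [set y : path_space | tail_equivalent x y].

Definition union_of_tail_classes (A : set path_space) : Prop :=
  exists C : set path_space, A = \bigcup_(x in C) tail_class x.

Section Measures.
Variable R : realType.
Implicit Types (mu : probability borel_path_space R) (d : int -> R).

Definition tail_invariant mu : Prop :=
  forall v p w q, is_finite_path v p -> is_finite_path w q ->
    last v p = last w q -> mu (cylinder v p) = mu (cylinder w q).

Definition ergodic mu : Prop :=
  forall A : set borel_path_space, measurable A -> union_of_tail_classes A ->
    mu A = 0%E \/ mu A = 1%E.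

Definition probability_vector d : Prop :=
  (forall i, 0 <= d i) /\ (\esum_(i in [set: int]) (d i)%:E = 1)%E.

(* The factors outside the support of s are equal to 1, also when d i = 0,
   since 0 ^+ 0 = 1. *)
Definition vertex_weight d (s : vertex) : R :=
  \prod_(i <- finsupp s) d i ^+ s i.

(* mu is the measure mu_d. *)
Definition is_vector_measure d mu : Prop :=
  tail_invariant mu /\
  forall v p, is_finite_path v p ->
    mu (cylinder v p) = (vertex_weight d (last v p))%:E.

End Measures.

(* Main.v *)
Require Import Defs.
From HB Require Import structures.
From mathcomp Require Import all_boot all_order all_algebra.
From mathcomp Require Import finmap.
From mathcomp Require Import all_classical all_reals all_analysis.
From mathcomp Require Import zify ring lra.

(** A path is the sequence of its steps, the i-th step being the integer at which
    the i-th vertex exceeds its predecessor; the vertex reached after a word w of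
    steps records how often each integer occurs in w. Tail invariant measures are
    thus the exchangeable laws of sequences of integers, tail equivalence is the
    orbit relation of the finite permutations of the steps ([tail_equivalentP]),
    and mu_d is the law of independent steps with distribution d
    ([is_vector_measureP]). The theorem combines the Hewitt-Savage zero-one law
    with the ergodic case of de Finetti's theorem. Below, [w] is the set of the
    paths whose sequence of steps starts with the word w.

    The law mu_d exists because its steps can be read off a uniform random number
    by an expanding interval map ([exists_vector_measure]). It is unique because
    the sets [w] form a pi-system that generates the Borel sets
    ([borel_measure_eq]).

    It is ergodic ([vector_measure_ergodic]) because, for a union A of tail
    classes, mu_d (A & [w]) / mu_d [w] depends on the multiset of letters of w
    only and is a bounded harmonic function of it for the random walk with step
    distribution d. By the Choquet-Deny theorem ([choquet_deny]) such a function
    is constant, which makes A independent of all sets [w], hence of itself.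

    Conversely, let mu be ergodic and tail invariant. The law of the path after a
    first step i, restricted to the event that this step is i, is exchangeable
    and dominated by mu. Ergodicity makes mu extremal among exchangeable
    measures ([ergodic_extremal], by a Hahn decomposition whose positive set is
    shrunk to a union of tail classes), so this law is a multiple of mu:
    mu [i w] = mu [i] * mu [w]. By induction mu is mu_d for d_i = mu [i]
    ([ergodic_vector_measure]). *)

Set Implicit Arguments.
Unset Strict Implicit.
Unset Printing Implicit Defensive.
Import Order.TTheory GRing.Theory Num.Theory.
Import numFieldNormedType.Exports.
Local Open Scope classical_set_scope.
Local Open Scope ring_scope.

(** * Vertices as multisets of integers, paths as sequences of steps *)

Definition count_vertex (w : seq int) : vertex :=
  [fsfun i in [fset j in w]%fset => count_mem i w].

Lemma count_vertexE w i : count_vertex w i = count_mem i w.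
Proof. by rewrite fsfunE !inE; case: ifPn => // /count_memPn ->. Qed.

Lemma finsupp_count_vertex w : finsupp (count_vertex w) = [fset j in w]%fset.
Proof.
apply/fsetP => i; rewrite mem_finsupp count_vertexE !inE.
by rewrite -lt0n -has_count has_pred1.
Qed.

Lemma prod_count_vertex (R : comNzRingType) (d : int -> R) w :
  \prod_(i <- finsupp (count_vertex w)) d i ^+ count_vertex w i =
  \prod_(i <- w) d i.
Proof.
rewrite finsupp_count_vertex -[RHS]prodr_undup_exp_count.
rewrite (perm_big (undup w)); first by apply: eq_bigr => i _; rewrite count_vertexE.
apply: uniq_perm => [||i]; rewrite ?fset_uniq ?undup_uniq//.
by rewrite mem_undup !inE.
Qed.

Lemma count_vertex_V w : V (size w) (count_vertex w).
Proof.
rewrite /V /= finsupp_count_vertex.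
under eq_bigr do rewrite count_vertexE.
rewrite -sum1_size -[RHS]big_undup_iterop_count.
rewrite [in LHS](perm_big (undup w)).
  by apply: eq_bigr => i _; case: (count_mem i w) => //; elim=> //= n {1}->.
by apply: uniq_perm => [||i]; rewrite ?fset_uniq ?undup_uniq// mem_undup !inE.
Qed.

Lemma count_vertex_rcons w i j :
  count_vertex (rcons w i) j = (count_vertex w j + unit_vertex i j)%N.
Proof.
rewrite !count_vertexE -cats1 count_cat /= addn0 /unit_vertex fsfun_withE.
by rewrite fsfunE eq_sym; case: eqP.
Qed.

Lemma count_vertex_eqP w w' : count_vertex w = count_vertex w' <-> perm_eq w w'.
Proof.
split=> [e|/permP e]; last first.
  by apply/fsfunP => i; rewrite !count_vertexE e.
by apply/allP => i _ /=; rewrite -!count_vertexE e.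
Qed.

Lemma V1_unit (s : vertex) : V 1 s -> exists i, s = count_vertex [:: i].
Proof.
rewrite /V /= => s1; have [s0|[i si]] := fset_0Vmem (finsupp s).
  by rewrite s0 big_seq_fset0 in s1.
exists i; apply/fsfunP => j; rewrite count_vertexE /= addn0.
move: s1 si; rewrite mem_finsupp => s1 si.
have := s1; rewrite (big_fsetD1 i) ?mem_finsupp//=.
have [<-|ji] := eqVneq i j; first lia.
have [/eqP ->//|sj] := boolP (s j == 0%N).
rewrite (big_fsetD1 j) ?inE ?mem_finsupp ?sj ?andbT//= 1?eq_sym//; lia.
Qed.

Lemma path_of_subproof (u : nat -> int) :
  is_infinite_path (fun k => count_vertex (mkseq u k.+1)).
Proof.
split=> k; first by have := count_vertex_V (mkseq u k.+1); rewrite size_mkseq.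
apply/asboolP; exists (u k.+1) => j.
by rewrite -[in RHS]count_vertex_rcons -mkseqS.
Qed.

Definition path_of u : path_space := PathSpace (path_of_subproof u).

(** The empty vertex precedes the first vertex of a path, so that the first
    vertex is reached by a step like all the others. *)
Definition previous_vertex (x : path_space) k : vertex :=
  if k is k'.+1 then x k' else count_vertex [::].

Definition step (x : path_space) k : int :=
  xget 0 [set i | x k =1 fun j => (previous_vertex x k j + unit_vertex i j)%N].

Lemma path_ext (x y : path_space) : x =1 y -> x = y.
Proof.
case: x y => [x xP] [y yP] /= /funext xy; subst y.
by congr PathSpace; exact: Prop_irrelevance.
Qed.

Lemma path_vertexE (x : path_space) k : x k = count_vertex (mkseq (step x) k.+1).
Proof.
have ex m : exists i, x m =1 fun j => (previous_vertex x m j + unit_vertex i j)%N.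
  case: m => [|m] /=; last by have [_ /(_ m) /asboolP] := path_spaceP x.
  have [/(_ 0%N) /V1_unit[i ->] _] := path_spaceP x.
  by exists i => j; rewrite -(count_vertex_rcons [::]).
have stepP m : x m =1 fun j => (previous_vertex x m j + unit_vertex (step x m) j)%N.
  by have [i xi] := ex m; rewrite /step; case: xgetP => // /(_ i).
elim: k => [|k IH]; apply/fsfunP => j.
  by rewrite mkseqS count_vertex_rcons stepP.
by rewrite mkseqS count_vertex_rcons -IH; exact: (stepP k.+1).
Qed.

Lemma stepK : cancel step path_of.
Proof. by move=> x; apply: path_ext => k; rewrite [RHS]path_vertexE. Qed.

Lemma path_ofK : cancel path_of step.
Proof.
move=> u; suff e k : mkseq (step (path_of u)) k = mkseq u k.
  apply/funext => k; have := congr1 (last 0) (e k.+1).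
  by rewrite !mkseqS !last_rcons.
elim: k => // k; rewrite !mkseqS => e; rewrite e; congr rcons.
have /fsfunP/(_ (u k)) := path_vertexE (path_of u) k.
rewrite /= !mkseqS e !count_vertex_rcons => /addnI.
rewrite /unit_vertex !fsfun_withE eqxx fsfunE.
by case: eqP.
Qed.

Lemma step_inj : injective step. Proof. exact: can_inj stepK. Qed.

Lemma mkseq_eqP (T : Type) (f g : nat -> T) n :
  mkseq f n = mkseq g n <-> forall k, (k < n)%N -> f k = g k.
Proof.
split=> [e k kn|e]; first by rewrite -(nth_mkseq (f 0%N) f kn) e nth_mkseq.
by apply/eq_in_map => k; rewrite mem_iota => /andP[_]; exact: e.
Qed.

(** The step of index k is read off the vertices of index at most k, whence
    initial segments of vertices and of steps carry the same information. *)
Lemma path_prefixP (x y : path_space) n :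
  (forall k, (k < n)%N -> x k = y k) <-> mkseq (step x) n = mkseq (step y) n.
Proof.
split=> [e|/mkseq_eqP e k kn]; last first.
  rewrite !path_vertexE; congr count_vertex; apply/mkseq_eqP => j jk.
  by apply: e; lia.
apply/mkseq_eqP => k kn; rewrite /step e//.
by case: k kn => // k kn; rewrite /= e//; lia.
Qed.

(** * Cylinders of words *)

(** Unlike the cylinders of finite paths, those of words include the whole
    space, for the empty word; with the empty set they form a pi-system that has
    the space as a member, and inductions on words can start there. *)
Definition word_cylinder (w : seq int) : set path_space :=
  [set x | mkseq (step x) (size w) = w].

Definition initial_path (x : path_space) n := mkseq (fun k => x k.+1) n.

Lemma initial_path_finite (x : path_space) n :
  is_finite_path (x 0%N) (initial_path x n).
Proof.
have [xV xe] := path_spaceP x; split; first exact: xV.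
apply/(pathP (x 0%N)) => k; rewrite size_mkseq => kn.
by case: k kn => [|k] kn /=; rewrite !nth_mkseq //; lia.
Qed.

Lemma last_initial_path (x : path_space) n : last (x 0%N) (initial_path x n) = x n.
Proof. by case: n => // n; rewrite /initial_path mkseqS last_rcons. Qed.

Lemma cylinder_initial_path (x : path_space) n :
  cylinder (x 0%N) (initial_path x n) =
  word_cylinder (mkseq (step x) n.+1).
Proof.
rewrite /cylinder /word_cylinder size_mkseq.
have nthE k : (k <= n)%N -> nth (x 0%N) (x 0%N :: initial_path x n) k = x k.
  by case: k => //= k kn; rewrite nth_mkseq.
apply/seteqP; split=> y /=; rewrite ?size_mkseq => yx.
  by apply/path_prefixP => k kn; rewrite yx// nthE.
by move=> k kn; rewrite nthE//; apply: (path_prefixP _ _ n.+1).2.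
Qed.

(** Every finite path extends to an infinite one. Facts about finite paths thus
    reduce to facts about initial segments of step sequences. *)
Lemma finite_path_initial v p : is_finite_path v p ->
  exists x : path_space, v = x 0%N /\ p = initial_path x (size p).
Proof.
case; elim/last_ind: p => [/V1_unit[i ->] _|p t IH v1].
  by exists (path_of (fun=> i)).
rewrite rcons_path => /andP[/(IH v1)[x [vx px]] /asboolP[i ti]].
pose u k := if (k <= size p)%N then step x k else i.
have ux k : (k <= size p)%N -> path_of u k = x k.
  move=> kp; rewrite [RHS]path_vertexE /=; congr count_vertex.
  by apply/mkseq_eqP => j jk; rewrite /u ifT//; lia.
exists (path_of u); rewrite ux//; split=> //.
rewrite size_rcons /initial_path mkseqS; congr rcons.
  by rewrite {1}px; apply/mkseq_eqP => k kp; rewrite ux.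
apply/fsfunP => j; rewrite ti [path_of u _]path_vertexE mkseqS.
rewrite count_vertex_rcons -path_vertexE ux// path_ofK /u ltnn.
by rewrite [in LHS]px vx last_initial_path.
Qed.

Definition path_shift n (x : path_space) : path_space :=
  path_of (fun k => step x (n + k)).

Definition prepend w (x : path_space) : path_space :=
  path_of (fun k => if (k < size w)%N then nth 0 w k else step x (k - size w)).

Lemma shift_prepend w x : path_shift (size w) (prepend w x) = x.
Proof.
apply: step_inj; rewrite path_ofK; apply/funext => k; rewrite path_ofK.
by rewrite ifF ?addKn//; lia.
Qed.

Lemma mkseq_nthE (w : seq int) (f : nat -> int) :
  (forall k, (k < size w)%N -> f k = nth 0 w k) -> mkseq f (size w) = w.
Proof. by move=> e; rewrite -[RHS](mkseq_nth 0); apply/mkseq_eqP. Qed.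

Lemma prepend_cylinder w x : word_cylinder w (prepend w x).
Proof. by apply: mkseq_nthE => k kw; rewrite path_ofK kw. Qed.

Lemma word_cylinderP w x :
  word_cylinder w x <-> forall k, (k < size w)%N -> step x k = nth 0 w k.
Proof.
split=> [e k kw|]; last exact: mkseq_nthE.
by rewrite -{1}e nth_mkseq.
Qed.

Lemma prepend_shift w x : word_cylinder w x -> prepend w (path_shift (size w) x) = x.
Proof.
move/word_cylinderP => xw; apply: step_inj; rewrite path_ofK.
apply/funext => k; case: ltnP => kw; first by rewrite xw.
by rewrite path_ofK subnKC.
Qed.

Lemma mkseq_cylinder x n : word_cylinder (mkseq (step x) n) x.
Proof. by rewrite /word_cylinder /mkset size_mkseq. Qed.

Lemma word_cylinder_cat w v :
  word_cylinder (w ++ v) =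
  word_cylinder w `&` path_shift (size w) @^-1` word_cylinder v.
Proof.
apply/seteqP; split=> [x /word_cylinderP xwv|].
  split; apply/word_cylinderP => k kw.
    by rewrite xwv ?nth_cat ?kw// size_cat; lia.
  rewrite path_ofK xwv; last by rewrite size_cat ltn_add2l.
  by rewrite nth_cat ltnNge leq_addr addKn.
move=> x [/word_cylinderP xw /word_cylinderP xv].
apply/word_cylinderP => k; rewrite size_cat nth_cat => kwv.
case: ltnP => kw; first exact: xw.
by rewrite -xv ?path_ofK ?subnKC ?ltn_subLR.
Qed.

Lemma word_cylinder0 : word_cylinder [::] = setT.
Proof. by apply/seteqP; split. Qed.

(** Two paths through the same vertex at level N have read the same multiset of
    steps before it, and agree afterwards exactly when their later steps agree.
    Tail equivalence is therefore the orbit relation of finite permutations of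
    the steps. *)
Lemma tail_equivalentP x y : tail_equivalent x y <->
  exists w w' z, [/\ perm_eq w w', x = prepend w z & y = prepend w' z].
Proof.
split=> [[N xy]|[w [w' [z [ww' -> ->]]]]]; last first.
  exists (size w) => n wn; rewrite !path_vertexE; apply/count_vertex_eqP.
  have sw := perm_size ww'.
  have mk v : (size v <= n)%N -> mkseq (step (prepend v z)) n.+1 =
      v ++ mkseq (step z) (n.+1 - size v).
    move=> vn; rewrite /mkseq -{1}(subnKC (leqW vn)) iotaD map_cat add0n.
    congr cat; first exact: prepend_cylinder.
    rewrite -[X in iota X _]addn0 iotaDl -map_comp; apply: eq_map => k /=.
    by rewrite path_ofK ltnNge leq_addr addKn.
  have w'n : (size w' <= n)%N by rewrite -sw.
  rewrite [X in perm_eq X _](mk w wn) [X in perm_eq _ X](mk w' w'n) -sw.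
  by rewrite perm_cat2r.
exists (mkseq (step x) N.+1), (mkseq (step y) N.+1), (path_shift N.+1 x).
have -> : path_shift N.+1 x = path_shift N.+1 y.
  congr path_of; apply/funext => k; rewrite /step /=.
  by rewrite !xy//; lia.
split; first by apply/count_vertex_eqP; rewrite -!path_vertexE xy.
  rewrite -[LHS](prepend_shift (mkseq_cylinder x N.+1)) size_mkseq.
  by congr prepend; congr path_of; apply/funext => k; rewrite /step /= !xy//; lia.
by rewrite -[LHS](prepend_shift (mkseq_cylinder y N.+1)) size_mkseq.
Qed.

(** * Borel sets of the path space *)

Lemma open_word_cylinder w : open (word_cylinder w).
Proof.
case: w => [|i w]; first by rewrite word_cylinder0; exact: openT.
have -> : i :: w = mkseq (step (path_of (nth 0 (i :: w)))) (size w).+1.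
  by rewrite path_ofK -[LHS](mkseq_nth 0).
rewrite -cylinder_initial_path.
set C := cylinder _ _.
exists [set C] => /=; last by rewrite bigcup_set1.
move=> _ ->; apply: (@finI_from1 _ _ _ id); eexists; eexists; split=> //.
exact: initial_path_finite.
Qed.

Lemma cylinder_word v p : is_finite_path v p ->
  exists w, cylinder v p = word_cylinder w.
Proof.
move=> /finite_path_initial [x [-> ->]].
by exists (mkseq (step x) (size p).+1); rewrite cylinder_initial_path.
Qed.

Lemma word_cylinder_nested w w' x : word_cylinder w x -> word_cylinder w' x ->
  (size w <= size w')%N -> word_cylinder w' `<=` word_cylinder w.
Proof.
move=> /word_cylinderP xw /word_cylinderP xw' ww' y /word_cylinderP yw'.
apply/word_cylinderP => k kw; have kw' := leq_trans kw ww'.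
by rewrite yw'// -xw'// xw.
Qed.

(** Cylinders through a common path form a chain, so that finite intersections
    of them are again such cylinders. *)
Lemma word_cylinder_bigcap (s : seq (set path_space)) x :
  (forall C, C \in s -> C x /\ exists w, C = word_cylinder w) ->
  exists2 w, word_cylinder w x & forall C, C \in s -> word_cylinder w `<=` C.
Proof.
elim: s => [_|C s IH Cs]; first by exists [::].
have [w xw ws] := IH (fun D Ds => Cs D (@mem_behead _ (C :: s) D Ds)).
have [xC [v Cv]] := Cs C (mem_head _ _); rewrite Cv in xC.
have [wv|/ltnW vw] := leqP (size w) (size v).
  exists v => // D; rewrite inE => /predU1P[->|/ws wD]; first by rewrite Cv.
  exact: subset_trans (word_cylinder_nested xw xC wv) wD.
exists w => // D; rewrite inE => /predU1P[->|/ws //].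
by rewrite Cv; exact: word_cylinder_nested xC xw vw.
Qed.

Lemma open_word_base (A : set path_space) x : open A -> A x ->
  exists2 w, word_cylinder w x & word_cylinder w `<=` A.
Proof.
move=> [D sD <-] [B DB Bx]; have [F sF FB] := sD _ DB.
have [C CF|w xw wF] := @word_cylinder_bigcap (enum_fset F) x.
  split; first by move: Bx; rewrite -FB; apply.
  by have := sF _ CF; rewrite inE => -[v [p [vp ->]]]; exact: cylinder_word.
exists w => //; apply: (@subset_trans _ B); last by move=> y By; exists B.
by rewrite -FB => y wy C CF; exact: wF wy.
Qed.

Definition word_cylinders : set (set path_space) :=
  [set A | A = set0 \/ exists w, A = word_cylinder w].

Lemma measurable_word_cylinder w :
  measurable (word_cylinder w : set borel_path_space).
Proof. by apply: sub_sigma_algebra; exact: open_word_cylinder. Qed.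

(** There are countably many words, hence an open set is a countable union of
    word cylinders. *)
Lemma borel_word_cylindersE :
  @measurable _ borel_path_space = <<s word_cylinders >>.
Proof.
apply/seteqP; split.
  apply: smallest_sub => [|A oA]; first exact: smallest_sigma_algebra.
  have -> : A = \bigcup_(w in [set w | word_cylinder w `<=` A]) word_cylinder w.
    apply/seteqP; split=> [x /(open_word_base oA)[w xw wA]|x [w wA /wA//]].
    by exists w.
  rewrite bigcup_mkcond.
  apply: (@countable_bigcupT_measurable _ (g_sigma_algebraType word_cylinders)).
    exact: countableP.
  move=> w; case: ifP => _; last exact: measurable0.
  by apply: sub_sigma_algebra; right; exists w.
apply: smallest_sub => [|A [->|[w ->]]]; first exact: sigma_algebra_measurable.
  exact: measurable0.
exact: measurable_word_cylinder.
Qed.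

Lemma setI_closed_word_cylinders : setI_closed word_cylinders.
Proof.
move=> _ _ [->|[w ->]] [->|[v ->]]; rewrite ?set0I ?setI0; try by left.
have [->|/set0P[x [xw xv]]] := eqVneq (word_cylinder w `&` word_cylinder v) set0.
  by left.
right; case: (leqP (size w) (size v)) => [wv|/ltnW vw].
  by exists v; rewrite setIidr//; exact: word_cylinder_nested xw xv wv.
by exists w; rewrite setIidl//; exact: word_cylinder_nested xv xw vw.
Qed.

Lemma borel_measure_eq (R : realType)
    (m1 m2 : {measure set borel_path_space -> \bar R}) :
  (m1 setT < +oo)%E ->
  (forall w, m1 (word_cylinder w) = m2 (word_cylinder w)) ->
  forall A, measurable A -> m1 A = m2 A.
Proof.
move=> fin e A mA.
apply: (@measure_unique _ _ borel_path_space word_cylinders (fun=> setT)) => //.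
- exact: borel_word_cylindersE.
- exact: setI_closed_word_cylinders.
- by move=> _; right; exists [::]; rewrite word_cylinder0.
- by rewrite bigcup_const.
- by move=> _ [->|[w ->]] //; rewrite !measure0.
Qed.

(** A map into the path space is measurable as soon as each single step of the
    image is. *)
Lemma measurable_to_paths d (U : measurableType d) (f : U -> borel_path_space) :
  (forall k i, measurable [set u | step (f u) k = i]) -> measurable_fun setT f.
Proof.
move=> mf.
apply: (@measurability _ _ U borel_path_space _ _ _ borel_word_cylindersE).
move=> _ [_ [->|[w ->]] <-]; rewrite setTI ?preimage_set0//.
rewrite (_ : _ @^-1` _ = \bigcap_k
   (if (k < size w)%N then [set u | step (f u) k = nth 0 w k] else setT)).
  by apply: bigcapT_measurable => k; case: ifP.
apply/seteqP; split=> u /=.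
  by move/word_cylinderP => fw k _; case: ifP => // /fw.
by move=> fw; apply/word_cylinderP => k kw; have := fw k I; rewrite kw.
Qed.

Lemma measurable_step k i :
  measurable ([set x | step x k = i] : set borel_path_space).
Proof.
rewrite (_ : [set x | _] = \bigcup_(w : seq int)
   (if size w == k then word_cylinder (rcons w i) else set0)).
  apply: countable_bigcupT_measurable => [|w]; first exact: countableP.
  by case: ifP => // _; exact: measurable_word_cylinder.
apply/seteqP; split=> [x /= <-|x [w _]].
  exists (mkseq (step x) k) => //; rewrite size_mkseq eqxx -mkseqS.
  exact: mkseq_cylinder.
case: eqP => // <- /word_cylinderP xw /=.
by rewrite xw ?size_rcons// nth_rcons ltnn eqxx.
Qed.

Lemma measurable_shift n :
  measurable_fun setT (path_shift n : borel_path_space -> borel_path_space).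
Proof.
apply: measurable_to_paths => k i.
rewrite (_ : [set u | _] = [set u | step u (n + k) = i]).
  exact: measurable_step.
by apply/seteqP; split=> u /=; rewrite path_ofK.
Qed.

Lemma measurable_prepend w :
  measurable_fun setT (prepend w : borel_path_space -> borel_path_space).
Proof.
apply: measurable_to_paths => k i.
have [kw|kw] := ltnP k (size w); last first.
  rewrite (_ : [set u | _] = [set u | step u (k - size w) = i]).
    exact: measurable_step.
  by apply/seteqP; split=> u /=; rewrite path_ofK ltnNge kw.
have [wi|wi] := eqVneq (nth 0 w k) i.
  rewrite (_ : [set u | _] = setT); first exact: measurableT.
  by apply/seteqP; split=> // u _ /=; rewrite path_ofK kw.
rewrite (_ : [set u | _] = set0); first exact: measurable0.
by apply/seteqP; split=> // u /=; rewrite path_ofK kw => /eqP; rewrite (negPf wi).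
Qed.

(** * Exchangeable additive functions on words *)

(** An explicit numbering of the integers turns sums and unions over them into
    sums and unions over the natural numbers; its order also places the
    intervals used for the existence of mu_d side by side. *)
Definition int_enum (n : nat) : int := if odd n then Negz n./2 else Posz n./2.

Definition int_index (i : int) : nat :=
  match i with Posz n => n.*2 | Negz n => n.*2.+1 end.

Lemma int_enumK : cancel int_enum int_index.
Proof.
move=> n; rewrite -[RHS]odd_double_half /int_enum.
by case: (odd n).
Qed.

Lemma int_indexK : cancel int_index int_enum.
Proof.
by case=> n; rewrite /int_enum /= ?odd_double /= ?uphalf_double ?doubleK.
Qed.

Lemma int_enum_bij : set_bij setT setT int_enum.
Proof.
rewrite setTT_bijective.
by exists int_index; [exact: int_enumK|exact: int_indexK].
Qed.

Lemma esum_int (R : realType) (f : int -> \bar R) : (forall i, 0 <= f i)%E ->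
  (\esum_(i in [set: int]) f i = \sum_(n <oo) f (int_enum n))%E.
Proof.
move=> f0; rewrite nneseries_esumT//.
exact: (reindex_esum _ _ _ _ int_enum_bij).
Qed.

Section ChoquetDeny.
Variables (R : realType) (d : int -> R).
Hypothesis dP : probability_vector d.

Definition word_weight (w : seq int) : R := \prod_(i <- w) d i.

Lemma word_weight_rcons w i : word_weight (rcons w i) = word_weight w * d i.
Proof. by rewrite /word_weight big_rcons. Qed.

Lemma word_weight_ge0 w : 0 <= word_weight w.
Proof. by apply: prodr_ge0 => i _; exact: dP.1. Qed.

Lemma probability_vector_le1 i : d i <= 1.
Proof.
have [d0 d1] := dP; rewrite -lee_fin -d1 -(@esum_set1 _ _ i (fun j => (d j)%:E)).
  by apply: esum_ge; exists [set i]; rewrite ?esum_set1 ?fsbig_set1 ?lee_fin.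
by rewrite lee_fin.
Qed.

(** A finite measure m yields such a function, w |-> m [w], because the cylinder
    of w is the disjoint union of those of its one-step extensions. *)
Definition additive_on_words (a : seq int -> R) :=
  forall w, (\esum_(i in [set: int]) (a (rcons w i))%:E = (a w)%:E)%E.

Lemma additive_on_wordsD f h : (forall w, 0 <= f w) -> (forall w, 0 <= h w) ->
  additive_on_words f -> additive_on_words h -> additive_on_words (f \+ h).
Proof.
move=> f0 h0 fadd hadd w; under eq_esum do rewrite EFinD.
by rewrite esumD; [rewrite fadd hadd|move=> i _; rewrite lee_fin..].
Qed.

Lemma additive_on_wordsB f h : (forall w, 0 <= h w) -> (forall w, h w <= f w) ->
  additive_on_words f -> additive_on_words h -> additive_on_words (f \- h).
Proof.
move=> h0 hf fadd hadd w; rewrite EFinB -(fadd w) -[X in (_ - X)%E]hadd.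
rewrite (_ : (\esum_(i in _) (f (rcons w i))%:E)%E =
    (\esum_(i in [set: int]) ((f \- h) (rcons w i))%:E +
     \esum_(i in [set: int]) (h (rcons w i))%:E)%E); last first.
  rewrite -esumD => [|i _|i _]; rewrite ?lee_fin ?subr_ge0//.
  by apply: eq_esum => i _; rewrite -EFinD subrK.
by rewrite hadd addeK.
Qed.

Lemma additive_on_wordsZ c f : 0 <= c -> (forall w, 0 <= f w) ->
  additive_on_words f -> additive_on_words (fun w => c * f w).
Proof.
move=> c0 f0 fadd w; rewrite EFinM -fadd !esum_int => [|i|i].
- rewrite -nneseriesZl => [|i _]; last by rewrite lee_fin.
  by apply: eq_eseriesr => i _; rewrite EFinM.
- by rewrite lee_fin.
- by rewrite lee_fin mulr_ge0.
Qed.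

Lemma additive_word_weight : additive_on_words word_weight.
Proof.
move=> w; rewrite esum_int => [|i]; last first.
  by rewrite lee_fin word_weight_ge0.
under eq_eseriesr do rewrite word_weight_rcons EFinM.
rewrite nneseriesZl => [|i _]; last by rewrite lee_fin; exact: dP.1.
rewrite -(@esum_int _ (fun i => (d i)%:E)) ?dP.2 ?mule1// => i.
by rewrite lee_fin dP.1.
Qed.

Lemma esum_single (i : int) (c : R) : 0 <= c ->
  (\esum_(j in [set: int]) (if j == i then c else 0)%:E = c%:E)%E.
Proof.
move=> c0; rewrite -[RHS](@esum_set1 _ _ i (fun=> c%:E)) ?lee_fin//.
rewrite [RHS]esum_mkcond; apply: eq_esum => j _.
by case: eqP => [->|ji]; [rewrite mem_set|rewrite memNset].
Qed.

Lemma additive_on_words_le (f : seq int -> R) w i :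
  (forall w, 0 <= f w) -> additive_on_words f -> f (rcons w i) <= f w.
Proof.
move=> f0 fadd; rewrite -lee_fin -(fadd w) -(esum_single i (f0 _)).
apply: le_esum => j _; rewrite lee_fin; case: eqP => [->|] //.
Qed.

Section DominatedExchangeable.
Variable a : seq int -> R.
Hypothesis a_ge0 : forall w, 0 <= a w.
Hypothesis a_le : forall w, a w <= word_weight w.
Hypothesis a_perm : forall w w', perm_eq w w' -> a w = a w'.
Hypothesis a_add : additive_on_words a.

(* Up to the factor word_weight (rcons w i), this is the increment of the
   harmonic function a / word_weight along the step i. *)
Let gap i w := a (rcons w i) - d i * a w.

(** Exchangeability allows i to be appended before the summation variable. *)
Lemma additive_on_words_rcons i : additive_on_words (fun w => a (rcons w i)).
Proof.
move=> w; rewrite -a_add; apply: eq_esum => j _; congr _%:E; apply: a_perm.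
by rewrite -!cats1 -!catA perm_cat2l perm_catC.
Qed.

(** The slack M * word_weight - gap i is additive in w, being a combination of
    additive functions, and it is nonnegative by hypothesis; such a function
    decreases along extensions. *)
Lemma gap_slack_le i M w : 0 <= M -> (forall w, gap i w <= M * word_weight w) ->
  M * word_weight (rcons w i) - gap i (rcons w i) <= M * word_weight w - gap i w.
Proof.
move=> M0 gM; pose f w := M * word_weight w + d i * a w - a (rcons w i).
have fE v : M * word_weight v - gap i v = f v by rewrite /f /gap; ring.
have d0 := dP.1 i.
rewrite !fE; apply: additive_on_words_le => [v|].
  by rewrite -fE subr_ge0.
apply: additive_on_wordsB => // [v| |].
- by have := gM v; rewrite /gap; lra.
- apply: additive_on_wordsD => [v|v||].
  + by rewrite mulr_ge0// word_weight_ge0.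
  + by rewrite mulr_ge0.
  + apply: additive_on_wordsZ => //; first exact: word_weight_ge0.
    exact: additive_word_weight.
  + exact: additive_on_wordsZ.
- exact: additive_on_words_rcons.
Qed.

(** Suppose that the supremum M of gap i / word_weight is positive and take a
    word v that almost attains it. Appending i does not increase the slack, so
    that the ratios a / word_weight along v, vi, vii, ... grow by at least M / 2
    at each of the first K steps. As these ratios lie in [0, 1], this fails for
    large K. *)
Lemma gap_le0 i w : gap i w <= 0.
Proof.
have d0 := dP.1 i; have d1 := probability_vector_le1 i.
have gle v : gap i v <= 1 * word_weight v.
  rewrite mul1r /gap lerBlDr (le_trans (a_le _))// word_weight_rcons.
  by rewrite (le_trans (ler_piMr _ d1)) ?word_weight_ge0// lerDl mulr_ge0.
rewrite leNgt; apply/negP => gw.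
pose E := [set r | exists2 v, 0 < word_weight v & r = gap i v / word_weight v].
have supE : has_sup E.
  split; first exists (gap i w / word_weight w), w => //.
    by have := lt_le_trans gw (gle w); rewrite mul1r.
  by exists 1 => _ [v v0 ->]; rewrite ler_pdivrMr.
set M := sup E.
have m0 := word_weight_ge0.
have gM v : gap i v <= M * word_weight v.
  have := m0 v; rewrite le_eqVlt => /predU1P[v0|v0].
    by rewrite -v0 mulr0 (le_trans (gle v))// -v0 mulr0.
  by rewrite -ler_pdivrMr//; apply: sup_ubound; [exact: supE.2|exists v].
have M0 : 0 < M.
  have w0 := lt_le_trans gw (gle w); rewrite mul1r in w0.
  by have := lt_le_trans gw (gM w); rewrite pmulr_lgt0.
have di0 : 0 < d i.
  rewrite lt_def d0 andbT; apply/eqP => di0; move: gw; rewrite /gap di0 mul0r subr0.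
  by rewrite ltNge (le_trans (a_le _))// word_weight_rcons di0 mulr0.
have [K MK] : exists K : nat, 2 < K%:R * M.
  exists (Num.bound (2 / M)); rewrite -ltr_pdivrMr//.
  by apply: archi_boundP; rewrite divr_ge0// ltW.
(* The slack at v must stay below half of M * word_weight at all the words
   v i^k with k <= K, and the smallest of these weights has the factor d_i^K. *)
have dl : 0 < M * d i ^+ K / 2 by rewrite divr_gt0// mulr_gt0// exprn_gt0.
have [_ [v v0 ->]] := sup_adherent dl supE; rewrite -/M ltr_pdivlMr// => gv.
pose vk k := iter k (rcons^~ i) v.
have mk k : word_weight (vk k) = d i ^+ k * word_weight v.
  elim: k => [|k IH]; first by rewrite expr0 mul1r.
  by rewrite [vk _]/= word_weight_rcons IH exprS; ring.
have slack k : M * word_weight (vk k) - gap i (vk k) <=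
    M * d i ^+ K / 2 * word_weight v.
  elim: k => [|k IH]; first by rewrite /=; lra.
  exact: le_trans (gap_slack_le _ (ltW M0) gM) IH.
have big k : (k <= K)%N ->
    k%:R * (M / 2) * (d i ^+ k * word_weight v) <= a (vk k).
  elim: k => [_|k IH kK]; first by rewrite !mul0r a_ge0.
  have := slack k; rewrite mk {1}/gap -[rcons _ _]/(vk k.+1) => sk.
  have := ler_wpM2l d0 (IH (ltnW kK)).
  have dK : d i ^+ K <= d i ^+ k by rewrite ler_wiXn2l// ltnW.
  have dSk : d i ^+ k.+1 <= d i ^+ k by rewrite ler_wiXn2l.
  have := ler_wpM2l (ltW (mulr_gt0 M0 v0)) dK.
  have := ler_wpM2l (ltW (mulr_gt0 M0 v0)) dSk.
  rewrite exprS -[k.+1%:R]natr1; lra.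
have := le_trans (big K (leqnn K)) (a_le _); rewrite mk.
have p0 : 0 < d i ^+ K * word_weight v by rewrite mulr_gt0// exprn_gt0.
by rewrite -[leRHS]mul1r ler_pM2r//; lra.
Qed.

End DominatedExchangeable.

(** The Choquet-Deny theorem for the random walk with step distribution d: the
    bounded harmonic function a / word_weight is constant. The bound on the gap
    applies to a and to word_weight - a, whose gaps are opposite. *)
Lemma choquet_deny (a : seq int -> R) :
  (forall w, 0 <= a w) -> (forall w, a w <= word_weight w) ->
  (forall w w', perm_eq w w' -> a w = a w') -> additive_on_words a ->
  forall w, a w = a [::] * word_weight w.
Proof.
move=> a0 am ap aadd; elim/last_ind => [|w i IH].
  by rewrite /word_weight big_nil mulr1.
suff : a (rcons w i) = d i * a w by rewrite IH word_weight_rcons => ->; ring.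
apply/eqP; rewrite -subr_eq0 eq_le gap_le0//=.
have := @gap_le0 (word_weight \- a) _ _ _ _ i w.
rewrite /= word_weight_rcons => h; rewrite -oppr_le0.
rewrite (_ : - _ = word_weight w * d i - a (rcons w i) -
                   d i * (word_weight w - a w)).
  apply: h => [v|v|v v' vv'|]; rewrite ?subr_ge0 ?gerBl//.
  - by rewrite (ap _ _ vv') /word_weight (perm_big _ vv').
  - by apply: additive_on_wordsB => //; exact: additive_word_weight.
by ring.
Qed.

End ChoquetDeny.

(** * Exchangeable measures on the path space *)

Definition exchangeable (R : realType) (m : set borel_path_space -> \bar R) :=
  forall w w', perm_eq w w' -> m (word_cylinder w) = m (word_cylinder w').

(** tail_part m w n is the distribution under m of the path from the step n on,
    restricted to the paths that start with w. For n = size w these are the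
    images of m under the deletion of the prefix w; exchangeability of m says
    that they do not depend on the order of the letters of w. *)
Section TailPart.
Variables (R : realType) (m : {finite_measure set borel_path_space -> \bar R}).
Variables (w : seq int) (n : nat).
Local Open Scope ereal_scope.

Definition tail_part (B : set borel_path_space) : \bar R :=
  m (word_cylinder w `&` path_shift n @^-1` B).

Lemma measurable_tail_part (B : set borel_path_space) : measurable B ->
  measurable (word_cylinder w `&` path_shift n @^-1` B
              : set borel_path_space).
Proof.
move=> mB; apply: measurableI; first exact: measurable_word_cylinder.
by rewrite -[X in measurable X]setTI; exact: measurable_shift.
Qed.

Let tail_part0 : tail_part set0 = 0.
Proof. by rewrite /tail_part preimage_set0 setI0 measure0. Qed.

Let tail_part_ge0 B : 0 <= tail_part B.
Proof. exact: measure_ge0. Qed.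

Let tail_part_sigma_additive : semi_sigma_additive tail_part.
Proof.
move=> F mF tF mUF; rewrite /tail_part preimage_bigcup setI_bigcupr.
apply: measure_semi_sigma_additive => [k| |].
- exact: measurable_tail_part.
- apply/trivIsetP => i j _ _ ij; rewrite setIACA setIid -preimage_setI.
  by move/trivIsetP : tF => /(_ _ _ _ _ ij) ->//; rewrite preimage_set0 setI0.
- by rewrite -setI_bigcupr -preimage_bigcup; exact: measurable_tail_part.
Qed.

HB.instance Definition _ := isMeasure.Build _ _ _ tail_part
  tail_part0 tail_part_ge0 tail_part_sigma_additive.

Let tail_part_fin : fin_num_fun tail_part.
Proof. by move=> B mB; rewrite fin_num_measure//; exact: measurable_tail_part. Qed.

HB.instance Definition _ := @Measure_isFinite.Build _ _ _ tail_part tail_part_fin.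

End TailPart.

Lemma tail_part_word (R : realType)
    (m : {finite_measure set borel_path_space -> \bar R}) w v :
  tail_part m w (size w) (word_cylinder v) = m (word_cylinder (w ++ v)).
Proof. by rewrite word_cylinder_cat. Qed.

Lemma tail_part_perm (R : realType)
    (m : {finite_measure set borel_path_space -> \bar R}) w w'
    (B : set borel_path_space) :
  exchangeable m -> perm_eq w w' -> measurable B ->
  tail_part m w (size w) B = tail_part m w' (size w') B.
Proof.
move=> mx ww'.
apply: (@borel_measure_eq R (tail_part m w (size w))
                            (tail_part m w' (size w'))) => [|v] /=.
  by rewrite -ge0_fin_numE// fin_num_measure.
by rewrite !tail_part_word; apply: mx; rewrite perm_cat2r.
Qed.

Lemma word_cylinder_rcons w i x :
  word_cylinder (rcons w i) x <-> word_cylinder w x /\ step x (size w) = i.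
Proof.
rewrite /word_cylinder /mkset size_rcons mkseqS; split=> [/rcons_inj[-> ->]//|].
by move=> [-> ->].
Qed.

Lemma measure_next_step (R : realType)
    (m : {measure set borel_path_space -> \bar R}) (B : set borel_path_space) w :
    measurable B ->
  (\esum_(i in [set: int]) m (B `&` word_cylinder (rcons w i)) =
   m (B `&` word_cylinder w))%E.
Proof.
move=> mB; rewrite esum_int//.
rewrite (_ : B `&` word_cylinder w =
    \bigcup_n (B `&` word_cylinder (rcons w (int_enum n)))); last first.
  rewrite -setI_bigcupr; congr (_ `&` _); apply/seteqP; split=> x.
    have [_ _ /(_ (step x (size w)) I)[n _ ns]] := int_enum_bij.
    by move=> xw; exists n => //; apply/word_cylinder_rcons.
  by move=> [n _ /word_cylinder_rcons[]].
rewrite measure_bigcup => [|n _|].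
- by apply: eq_eseriesl => n; rewrite in_setT.
- by apply: measurableI => //; exact: measurable_word_cylinder.
- apply/trivIsetP => i j _ _ ij; apply/seteqP; split=> // x.
  move=> [[_ /word_cylinder_rcons[_ xi]] [_ /word_cylinder_rcons[_ xj]]].
  have [_ inj _] := int_enum_bij.
  by case/eqP: ij; apply: inj; rewrite ?inE//= -xi -xj.
Qed.

Lemma path_word_cylinder w : w != [::] ->
  exists x n, w = mkseq (step x) n.+1.
Proof.
case: w => // i w _; exists (path_of (nth 0 (i :: w))), (size w).
by rewrite path_ofK -[LHS](mkseq_nth 0).
Qed.

Lemma tail_invariant_exchangeable (R : realType)
    (mu : probability borel_path_space R) :
  tail_invariant mu -> exchangeable mu.
Proof.
move=> mti w w' ww'.
have [w0|wN0] := eqVneq w [::].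
  by move: ww'; rewrite w0 perm_sym => /perm_nilP ->.
have w'N0 : w' != [::].
  by apply: contra_neq wN0 => w'0; apply/perm_nilP; rewrite -w'0.
have [x [m wx]] := path_word_cylinder wN0.
have [y [n wy]] := path_word_cylinder w'N0.
have := @mti _ _ _ _ (initial_path_finite x m) (initial_path_finite y n).
rewrite !cylinder_initial_path -wx -wy; apply; rewrite !last_initial_path.
by rewrite !path_vertexE -wx -wy; apply/count_vertex_eqP.
Qed.

Lemma is_vector_measureP (R : realType) (d : int -> R)
    (mu : probability borel_path_space R) :
  is_vector_measure d mu <->
  forall w, mu (word_cylinder w) = (word_weight d w)%:E.
Proof.
split=> [[_ mud] w|mud].
  have [->|/path_word_cylinder[x [n ->]]] := eqVneq w [::].
    by rewrite word_cylinder0 probability_setT /word_weight big_nil.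
  rewrite -cylinder_initial_path mud; last exact: initial_path_finite.
  by rewrite last_initial_path path_vertexE /vertex_weight prod_count_vertex.
have mudc v p : is_finite_path v p ->
    mu (cylinder v p) = (vertex_weight d (last v p))%:E.
  move=> /finite_path_initial[x [-> ->]].
  rewrite cylinder_initial_path mud last_initial_path path_vertexE.
  by rewrite /vertex_weight prod_count_vertex.
by split=> // v p w q vp wq e; rewrite !mudc// e.
Qed.

Lemma union_of_tail_classes_prepend A w w' x : union_of_tail_classes A ->
  perm_eq w w' -> A (prepend w x) -> A (prepend w' x).
Proof.
move=> [C ->] ww' [y Cy /tail_equivalentP [v [v' [z [vv' yv xv']]]]]; exists y => //.
have : tail_equivalent (prepend w x) (prepend w' x).
  by apply/tail_equivalentP; exists w, w', x.
have : tail_equivalent y (prepend w x) by apply/tail_equivalentP; exists v, v', z.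
move=> [M yM] [N xN]; exists (maxn M N) => n; rewrite geq_max => /andP[Mn Nn].
by rewrite yM// xN.
Qed.

(** * The measures mu_d are ergodic *)

(** If A is a union of tail classes, then w |-> mu (A & [w]) is exchangeable and
    is bounded by mu [w], hence equals mu A * mu [w]. So A is independent of
    every cylinder, then of every Borel set, then of itself, and
    mu A = (mu A)^2. *)
Lemma vector_measure_ergodic (R : realType) (d : int -> R)
    (mu : probability borel_path_space R) :
  probability_vector d -> is_vector_measure d mu -> ergodic mu.
Proof.
move=> dP mud A mA Atail; have [muti _] := mud.
have mux := tail_invariant_exchangeable muti.
move/is_vector_measureP in mud.
have mI w : measurable (A `&` word_cylinder w : set borel_path_space).
  by apply: measurableI => //; exact: measurable_word_cylinder.
have finI w : mu (A `&` word_cylinder w) \is a fin_num by rewrite fin_num_measure.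
have finA : mu A \is a fin_num by rewrite fin_num_measure.
pose a w := fine (mu (A `&` word_cylinder w)).
(* A & [w] consists of the paths w z such that A contains w z, a condition on z
   that is invariant under permutations of w. *)
have AE w : A `&` word_cylinder w =
    word_cylinder w `&` path_shift (size w) @^-1` (prepend w @^-1` A).
  apply/seteqP; split=> x /= [].
    by move=> Ax xw; rewrite prepend_shift.
  by move=> xw; rewrite prepend_shift.
have a_perm w w' : perm_eq w w' -> a w = a w'.
  move=> ww'; rewrite /a (AE w) (AE w'); apply: (congr1 fine).
  have -> : prepend w @^-1` A = prepend w' @^-1` A.
    apply/seteqP; split=> x; apply: union_of_tail_classes_prepend => //.
    by rewrite perm_sym.
  apply: (tail_part_perm mux ww').
  by rewrite -[X in measurable X]setTI; exact: measurable_prepend.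
have aE w : mu (A `&` word_cylinder w) = (a [::] * word_weight d w)%:E.
  rewrite -(@choquet_deny R d dP a) => [|v|v|v v' vv'|v].
  - by rewrite fineK.
  - exact: fine_ge0.
  - rewrite -lee_fin fineK// -mud; apply: le_measure; rewrite ?inE//.
    exact: measurable_word_cylinder.
  - exact: a_perm.
  - rewrite fineK//; under eq_esum do rewrite fineK//.
    exact: measure_next_step.
have a0 : 0 <= a [::] by exact: fine_ge0.
have aA : a [::] = fine (mu A) by rewrite /a word_cylinder0 setIT.
have : mrestr mu mA A = mscale (NngNum a0) mu A.
  apply: borel_measure_eq => // [|w].
    by change (mu (setT `&` A) < +oo)%E; rewrite setTI -ge0_fin_numE.
  change (mu (word_cylinder w `&` A) = (a [::])%:E * mu (word_cylinder w))%E.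
  by rewrite setIC aE EFinM mud.
rewrite /mrestr /mscale /= setIid aA.
rewrite -[in LHS](fineK finA) -[X in _ = (_ * X)%E](fineK finA) -EFinM => -[].
move=> /esym/eqP; rewrite -subr_eq0 -{3}[fine _]mulr1 -mulrBr mulf_eq0.
move=> /orP[/eqP f0|]; first by left; rewrite -(fineK finA) f0.
by rewrite subr_eq0 => /eqP f1; right; rewrite -(fineK finA) f1.
Qed.

(** * Ergodic measures are measures mu_d *)

(** An ergodic exchangeable mu is extremal: an exchangeable nu absolutely
    continuous with respect to mu is a multiple of mu. Let kappa be the
    difference of nu and the multiple of mu with the same mass, and P a positive
    set of a Hahn decomposition of kappa. Then P can be made a union of tail
    classes without changing kappa P, and ergodicity gives kappa P = 0. *)
Section Extremality.
Variables (R : realType) (mu : probability borel_path_space R).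
Variable nu : {finite_measure set borel_path_space -> \bar R}.
Hypotheses (mux : exchangeable mu) (mu_ergodic : ergodic mu).
Hypotheses (nux : exchangeable nu).
Hypothesis nu_mu : forall A, measurable A -> mu A = 0%E -> nu A = 0%E.
Local Open Scope ereal_scope.

Let c := fine (nu setT).
Let kappa : {charge set borel_path_space -> \bar R} :=
  cadd (charge_of_finite_measure nu)
       (cscale (- c) (charge_of_finite_measure mu)).

Let kappaE A : kappa A = nu A + (- c)%:E * mu A. Proof. by []. Qed.

Let kappaT : kappa setT = 0.
Proof.
by rewrite kappaE probability_setT mule1 EFinN fineK ?subee ?fin_num_measure.
Qed.

Let kappa_null A : measurable A -> mu A = 0 -> kappa A = 0.
Proof. by move=> mA A0; rewrite kappaE A0 nu_mu// mule0 adde0. Qed.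

(** The largest union of tail classes contained in A. *)
Definition tail_class_core (A : set path_space) : set path_space :=
  [set x | tail_class x `<=` A].

Lemma union_of_tail_class_core A : union_of_tail_classes (tail_class_core A).
Proof.
exists (tail_class_core A); apply/seteqP; split=> [x xA|y [x xA xy] z yz].
  by exists x => //; exists 0%N.
apply: xA; move: xy yz => [M xy] [N yz].
by exists (maxn M N) => n; rewrite geq_max => /andP[Mn Nn]; rewrite xy// yz.
Qed.

(* The paths of A with prefix p.1 that leave A when this prefix is replaced by
   its permutation p.2; the countably many such sets cover the part of A outside
   the tail class core. *)
Let escape (A : set path_space) (p : seq int * seq int) : set path_space :=
  if perm_eq p.1 p.2 then
    word_cylinder p.1 `&`
      path_shift (size p.1) @^-1` (prepend p.1 @^-1` A `&` prepend p.2 @^-1` ~` A)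
  else set0.

Let tail_class_core_escape A : tail_class_core A = A `\` \bigcup_p escape A p.
Proof.
apply/seteqP; split=> [x xA|x [Ax xA] y].
  split; first by apply: xA; exists 0%N.
  case=> -[w w'] _; rewrite /escape /=; case: ifP => // ww' [xw [_]]; apply.
  apply: xA; apply/tail_equivalentP; exists w, w', (path_shift (size w) x).
  by split=> //; rewrite prepend_shift.
move=> /tail_equivalentP[w [w' [z [ww' xE yE]]]]; apply: contrapT => Ay; apply: xA.
exists (w, w') => //; rewrite /escape /= ww' xE; split.
  exact: prepend_cylinder.
by rewrite /preimage /= shift_prepend -xE -yE.
Qed.

Let measurable_prepend_preimage w (A : set borel_path_space) : measurable A ->
  measurable (prepend w @^-1` A : set borel_path_space).
Proof.
by move=> mA; rewrite -[X in measurable X]setTI; exact: measurable_prepend.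
Qed.

Let measurable_escape (A : set borel_path_space) p :
  measurable A -> measurable (escape A p : set borel_path_space).
Proof.
move=> mA; rewrite /escape; case: ifP => // _; apply: measurable_tail_part.
apply: measurableI; apply: measurable_prepend_preimage => //.
exact: measurableC.
Qed.

Let measurable_escapes (A : set borel_path_space) : measurable A ->
  measurable (\bigcup_p escape A p : set borel_path_space).
Proof.
move=> mA; apply: countable_bigcupT_measurable => [|p]; first exact: countableP.
exact: measurable_escape.
Qed.

(* The replacement of prefixes preserves kappa and moves a subset of P into N, so
   that the value of kappa on this subset is both nonnegative and nonpositive. *)
Let kappa_escape (P N : set borel_path_space) p :
  hahn_decomposition kappa P N -> kappa (escape P p) = 0.
Proof.
move=> [[mP posP] [mN negN] PN PN0].
have NE x : ~ P x -> N x by move=> Px; have : (P `|` N) x; [rewrite PN|case].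
case: p => w w'; rewrite /escape /=; case: ifPn => [ww'|_]; last exact: charge0.
pose F := prepend w @^-1` P `&` prepend w' @^-1` ~` P.
rewrite -/F.
have mF : measurable (F : set borel_path_space).
  apply: measurableI; apply: measurable_prepend_preimage => //.
  exact: measurableC.
have swap : kappa (word_cylinder w `&` path_shift (size w) @^-1` F) =
    kappa (word_cylinder w' `&` path_shift (size w') @^-1` F).
  transitivity (tail_part nu w (size w) F +
                (- c)%:E * tail_part mu w (size w) F); first by [].
  by rewrite (tail_part_perm nux ww' mF) (tail_part_perm mux ww' mF).
apply/eqP; rewrite eq_le; apply/andP; split; last first.
  apply: posP; first exact: measurable_tail_part.
  by move=> x [xw [xP _]]; rewrite -(prepend_shift xw); exact: xP.
rewrite swap; apply: negN; first exact: measurable_tail_part.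
by move=> x [xw [_ xP]]; rewrite -(prepend_shift xw); exact: NE.
Qed.

Let kappa_escapes (P N : set borel_path_space) :
  hahn_decomposition kappa P N -> kappa (P `&` \bigcup_p escape P p) = 0.
Proof.
move=> PN; have [[mP posP] _ _ _] := PN.
have Psub p : escape P p `<=` P.
  rewrite /escape; case: ifP => _ x //; move=> [xw [xP _]].
  by rewrite -(prepend_shift xw); exact: xP.
pose pos := jordan_pos PN.
have posE B : measurable B -> pos B = kappa (B `&` P).
  by move=> mB; rewrite /pos jordan_posE cjordan_posE /crestr0 mem_set.
rewrite setIC -posE; last exact: measurable_escapes.
pose F n := if (choice.unpickle n : option (seq int * seq int)) is Some p
  then escape P p else set0.
have mF n : measurable (F n : set borel_path_space).
  by rewrite /F; case: choice.unpickle => // p; exact: measurable_escape.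
have -> : \bigcup_p escape P p = \bigcup_n F n.
  apply/seteqP; split=> x [].
    by move=> p _ xp; exists (choice.pickle p) => //; rewrite /F choice.pickleK.
  by move=> n _; rewrite /F; case: choice.unpickle => // p xp; exists p.
apply/negligibleP; first exact: bigcupT_measurable.
apply: negligible_bigcup => n; apply/negligibleP => //.
apply: (eq_trans (posE _ (mF n))); rewrite /F.
case: choice.unpickle => [p|]; last by rewrite set0I charge0.
by rewrite setIidl// (kappa_escape p PN).
Qed.

Lemma ergodic_extremal A : measurable A -> nu A = nu setT * mu A.
Proof.
have [P [N PN]] := Hahn_decomposition kappa.
have [[mP posP] [mN negN] PUN PIN] := PN.
pose core := tail_class_core P.
have mcore : measurable (core : set borel_path_space).
  rewrite /core tail_class_core_escape; apply: measurableD => //.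
  exact: measurable_escapes.
have kcore : kappa P = kappa core.
  rewrite (chargeDI kappa mP (measurable_escapes mP)) (kappa_escapes PN) adde0.
  by rewrite /core tail_class_core_escape.
have kP : kappa P = 0.
  rewrite kcore.
  have [core0|core1] := mu_ergodic mcore (union_of_tail_class_core P).
    exact: kappa_null.
  have mC : measurable (~` core : set borel_path_space) by exact: measurableC.
  rewrite -[LHS]adde0 -[X in _ + X](kappa_null mC); last first.
    by rewrite probability_setC// core1 subee.
  rewrite -chargeU ?setUv//; by rewrite setICr.
have k_le0 B : measurable B -> kappa B <= 0.
  move=> mB; rewrite (charge_partition kappa mB mP mN PUN PIN).
  have mBP : measurable (B `&` P : set borel_path_space) by exact: measurableI.
  have mPB : measurable (P `\` B : set borel_path_space) by exact: measurableD.
  have -> : kappa (B `&` P) = 0.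
    apply/eqP; rewrite eq_le posP//= andbT -kP (chargeDI kappa mP mB) setIC.
    by rewrite leeDr// posP.
  by rewrite add0e negN//; exact: measurableI.
have k0 B : measurable B -> kappa B = 0.
  move=> mB; apply/eqP; rewrite eq_le k_le0//= -kappaT -(setUv B).
  have mC := measurableC mB.
  by rewrite chargeU ?setICr// geeDl// k_le0.
move=> mA; have := k0 A mA; rewrite kappaE EFinN mulNe => kA.
have muA : mu A \is a fin_num by rewrite fin_num_measure.
rewrite -[LHS](@subeK _ _ (c%:E * mu A)) ?fin_numM// kA add0e.
by rewrite fineK// fin_num_measure.
Qed.

End Extremality.

Section ErgodicVector.
Variables (R : realType) (mu : probability borel_path_space R).
Hypotheses (mu_ti : tail_invariant mu) (mu_ergodic : ergodic mu).
Local Open Scope ereal_scope.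

Let mux := tail_invariant_exchangeable mu_ti.

(** Exchangeability moves a letter from the front to the back of a word. *)
Lemma exchangeable_stationary (B : set borel_path_space) : measurable B ->
  mu (path_shift 1 @^-1` B) = mu B.
Proof.
move=> mB; transitivity (tail_part mu [::] 1 B).
  by rewrite /tail_part word_cylinder0 setTI.
apply: borel_measure_eq => // [|v]; rewrite /= /tail_part word_cylinder0 setTI.
  by rewrite preimage_setT probability_setT ltry.
have mv : measurable (path_shift 1 @^-1` word_cylinder v : set borel_path_space).
  rewrite -[X in measurable X]setTI; apply: measurable_shift => //.
  exact: measurable_word_cylinder.
rewrite -[X in mu X = _]setIT -word_cylinder0.
rewrite -(measure_next_step mu [::] mv) -[X in _ = mu X]setTI.
rewrite -(measure_next_step mu v measurableT).
apply: eq_esum => i _; rewrite setIC -(word_cylinder_cat [:: i] v).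
rewrite [X in _ = mu X]setTI; apply: mux.
by rewrite -cats1 perm_catC; exact: perm_refl.
Qed.

(** The distribution of the path after a first step i is exchangeable, and
    absolutely continuous by stationarity, hence it is mu [i] times mu by
    extremality; that is, mu [i w] = mu [i] * mu [w]. *)
Lemma ergodic_vector_measure :
  exists d : int -> R, probability_vector d /\ is_vector_measure d mu.
Proof.
pose d i := fine (mu (word_cylinder [:: i])).
have mcyl w : mu (word_cylinder w) \is a fin_num.
  by rewrite fin_num_measure//; exact: measurable_word_cylinder.
have dE i : (d i)%:E = mu (word_cylinder [:: i]) by rewrite /d fineK.
exists d; split.
  split=> [i|]; first exact: fine_ge0.
  transitivity (mu (setT `&` word_cylinder [::])).
    rewrite -(measure_next_step mu [::] measurableT).
    by apply: eq_esum => i _; rewrite dE [X in _ = mu X]setTI.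
  by rewrite word_cylinder0 setTI probability_setT.
apply/is_vector_measureP; elim=> [|i w IH].
  by rewrite word_cylinder0 probability_setT /word_weight big_nil.
rewrite -[i :: w]/([:: i] ++ w) -(tail_part_word mu [:: i]).
have := @ergodic_extremal R mu (tail_part mu [:: i] 1) mux mu_ergodic _ _
  (word_cylinder w) (measurable_word_cylinder w).
rewrite /= => ->.
- rewrite preimage_setT setIT IH -dE -EFinM.
  by rewrite /word_weight big_cons.
- move=> v v' vv'; rewrite !(tail_part_word mu [:: i]); apply: mux.
  by rewrite perm_cat2l.
- move=> A mA A0; apply/eqP; rewrite eq_le measure_ge0 andbT.
  rewrite -A0 -(exchangeable_stationary mA) /tail_part /=.
  apply: le_measure; rewrite ?inE.
  + exact: (measurable_tail_part [:: i] 1).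
  + by rewrite -[X in measurable X]setTI; exact: measurable_shift.
  + exact: subIsetr.
Qed.

End ErgodicVector.

(** * Existence of the measures mu_d *)

(** Independent steps with distribution d are produced from a uniform u with
    0 <= u < 1 by an expanding map. The unit interval is cut into slots of
    lengths d_i, the slot that contains u gives the first step, and the affine
    map of this slot onto the unit interval gives the number that codes the
    remaining steps. *)
Section Coding.
Variables (R : realType) (d : int -> R).
Hypothesis dP : probability_vector d.

Let d0 i : 0 <= d i. Proof. exact: dP.1. Qed.

Definition cumulative (n : nat) : R := \sum_(0 <= k < n) d (int_enum k).

Lemma cumulativeS n : cumulative n.+1 = cumulative n + d (int_enum n).
Proof. by rewrite /cumulative big_nat_recr. Qed.

Lemma cumulative_ndecr m n : (m <= n)%N -> cumulative m <= cumulative n.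
Proof.
elim: n => [|n IH]; first by rewrite leqn0 => /eqP ->.
rewrite leq_eqVlt => /predU1P[->//|/IH/le_trans]; apply.
by rewrite cumulativeS lerDl.
Qed.

Lemma cumulative_cvg : cumulative n @[n --> \oo] --> (1 : R).
Proof.
have := dP.2; rewrite esum_int => [|i]; last by rewrite lee_fin.
move=> dsum; have : (cumulative n)%:E @[n --> \oo] --> 1%:E.
  rewrite -dsum (_ : (fun n => _) =
      fun n => (\sum_(0 <= k < n) (d (int_enum k))%:E)%E).
    by apply: is_cvg_nneseries => n _ _; rewrite lee_fin.
  by apply/funext => n; rewrite /cumulative sumEFin.
by move/fine_cvg.
Qed.

Lemma cumulative_le1 n : cumulative n <= 1.
Proof.
rewrite -(cvg_lim _ cumulative_cvg)//; apply: nondecreasing_cvgn_le.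
  exact: cumulative_ndecr.
by apply/cvg_ex; exists 1; exact: cumulative_cvg.
Qed.

Lemma cumulative_gt u : u < 1 -> exists n, u < cumulative n.
Proof.
move=> u1; have /cvgrPdist_lt/(_ (1 - u)) := cumulative_cvg.
rewrite subr_gt0 => /(_ u1)[n _ /(_ n (leqnn n))] /=.
rewrite ger0_norm ?subr_ge0 ?cumulative_le1// => un; exists n; lra.
Qed.

Let slot i u := cumulative (int_index i) <= u < cumulative (int_index i) + d i.

(** The default value 0 is only taken outside the unit interval. *)
Definition digit (u : R) : int := xget 0 [set i | slot i u].

Definition rescale (u : R) : R :=
  (u - cumulative (int_index (digit u))) / d (digit u).

Definition coding (u : measurableTypeR R) : borel_path_space :=
  path_of (fun k => digit (iter k rescale u)).

(** The numbers whose expansion starts with w form the interval of length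
    word_weight d w with this left end. *)
Fixpoint word_start (w : seq int) : R :=
  if w is i :: w' then cumulative (int_index i) + d i * word_start w' else 0.

Let slotSE i u :
  slot i u -> cumulative (int_index i) <= u < cumulative (int_index i).+1.
Proof. by rewrite cumulativeS int_indexK. Qed.

Lemma slot_uniq i j u : slot i u -> slot j u -> i = j.
Proof.
move=> /slotSE/andP[iu ui] /slotSE/andP[ju uj].
suff /(congr1 int_enum) : int_index i = int_index j by rewrite !int_indexK.
have [ij|ji|//] := ltngtP (int_index i) (int_index j).
  by have := lt_le_trans ui (le_trans (cumulative_ndecr ij) ju); rewrite ltxx.
by have := lt_le_trans uj (le_trans (cumulative_ndecr ji) iu); rewrite ltxx.
Qed.

Lemma slot_exists u : 0 <= u < 1 -> exists i, slot i u.
Proof.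
move=> /andP[u0 /cumulative_gt u1]; have [[|n] un nmin] := ex_minnP u1.
  by move: un; rewrite /cumulative big_geq// ltNge u0.
exists (int_enum n); rewrite /slot int_enumK -cumulativeS un andbT leNgt.
by apply/negP => /nmin; rewrite ltnn.
Qed.

Lemma digitE i u : 0 <= u < 1 -> digit u = i <-> slot i u.
Proof.
move=> /slot_exists[j uj]; rewrite /digit; case: xgetP => [k _ uk|/(_ j)//].
by split=> [<-//|]; exact: slot_uniq uk.
Qed.

Lemma word_start_bounds w : 0 <= word_start w /\ word_start w + word_weight d w <= 1.
Proof.
elim: w => [|i w [s0 s1]]; first by rewrite /= /word_weight big_nil add0r.
have c0 : 0 <= cumulative (int_index i).
  by have := cumulative_ndecr (leq0n (int_index i)); rewrite {1}/cumulative big_geq.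
have c1 := cumulative_le1 (int_index i).+1; rewrite cumulativeS int_indexK in c1.
split; first by rewrite /= addr_ge0// mulr_ge0.
have := ler_wpM2l (d0 i) s1.
rewrite /= [word_weight d (i :: w)]/word_weight big_cons -/(word_weight d w); lra.
Qed.

Lemma coding_word w u : 0 <= u < 1 ->
  word_cylinder w (coding u) <-> word_start w <= u < word_start w + word_weight d w.
Proof.
elim: w u => [|i w IH] u u01.
  by rewrite word_cylinder0 /= /word_weight big_nil add0r u01.
have -> : word_cylinder (i :: w) (coding u) <->
    slot i u /\ word_cylinder w (coding (rescale u)).
  rewrite -(digitE i u01) -cat1s word_cylinder_cat /setI /mkset /preimage /mkset.
  have -> : path_shift (size [:: i]) (coding u) = coding (rescale u).
    by congr path_of; apply/funext => k; rewrite path_ofK iterSr.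
  rewrite /word_cylinder /mkset /= /mkseq /= path_ofK /=.
  by split=> [[[->]]|[->]].
have [s0 s1] := word_start_bounds w.
rewrite /= [word_weight d (i :: w)]/word_weight big_cons -/(word_weight d w).
have [di0|di0] := eqVneq (d i) 0.
  by rewrite /slot di0 !mul0r !addr0; split=> [[]|]; lra.
have {}di0 : 0 < d i by rewrite lt_def di0 d0.
have slotP : slot i u ->
    0 <= rescale u < 1 /\ rescale u = (u - cumulative (int_index i)) / d i.
  move=> ui; have rE : rescale u = (u - cumulative (int_index i)) / d i.
    by rewrite /rescale (digitE i u01).2.
  split=> //; rewrite rE; move: ui => /andP[ui iu].
  by rewrite divr_ge0 ?subr_ge0//= ltr_pdivrMr//; lra.
split=> [[ui]|uw].
  have [/IH r01 rE] := slotP ui; move=> /r01; rewrite rE.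
  by rewrite ler_pdivlMr// ltr_pdivrMr//; lra.
have ui : slot i u.
  have p0 := mulr_ge0 (ltW di0) s0; have := ler_wpM2l (ltW di0) s1.
  by rewrite /slot; move: uw; lra.
split=> //; have [/IH r01 rE] := slotP ui; apply/r01; rewrite rE.
by rewrite ler_pdivlMr// ltr_pdivrMr//; lra.
Qed.

Let unit_interval : set (measurableTypeR R) := [set` `[0%R, 1%R[].

Lemma coding_word_interval w : unit_interval `&` coding @^-1` word_cylinder w =
  [set` `[word_start w, word_start w + word_weight d w[].
Proof.
have [s0 s1] := word_start_bounds w.
apply/seteqP; split=> u; rewrite /unit_interval /= !in_itv /=.
  by move=> [u01 /(coding_word w u01)].
move=> uw; have u01 : 0 <= u < 1 by lra.
by split=> //; apply/(coding_word w u01).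
Qed.

Lemma measurable_coding : measurable_fun unit_interval coding.
Proof.
apply: (@measurability _ _ (measurableTypeR R) borel_path_space _ _ _
  borel_word_cylindersE).
move=> _ [_ [->|[w ->]] <-]; first by rewrite preimage_set0 setI0.
by rewrite coding_word_interval; exact: measurable_itv.
Qed.

Definition coded_measure (A : set borel_path_space) : \bar R :=
  lebesgue_measure (unit_interval `&` coding @^-1` A).

Let measurable_unit_interval : measurable unit_interval.
Proof. exact: measurable_itv. Qed.

Let coded_measure0 : coded_measure set0 = 0%E.
Proof. by rewrite /coded_measure preimage_set0 setI0 measure0. Qed.

Let coded_measure_ge0 A : (0 <= coded_measure A)%E.
Proof. exact: measure_ge0. Qed.

Let coded_measure_sigma_additive : semi_sigma_additive coded_measure.
Proof.
move=> F mF tF mUF; rewrite /coded_measure preimage_bigcup setI_bigcupr.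
apply: measure_semi_sigma_additive => [k| |].
- exact: measurable_coding.
- apply/trivIsetP => i j _ _ ij; rewrite setIACA setIid -preimage_setI.
  by move/trivIsetP : tF => /(_ _ _ _ _ ij) ->//; rewrite preimage_set0 setI0.
- by rewrite -setI_bigcupr -preimage_bigcup; exact: measurable_coding.
Qed.

HB.instance Definition _ := isMeasure.Build _ _ _ coded_measure
  coded_measure0 coded_measure_ge0 coded_measure_sigma_additive.

Lemma coded_measure_word w :
  coded_measure (word_cylinder w) = (word_weight d w)%:E.
Proof.
rewrite /coded_measure coding_word_interval lebesgue_measure_itv /= lte_fin.
rewrite ltrDl; have := word_weight_ge0 dP w; rewrite le_eqVlt => /predU1P[<-|w0].
  by rewrite ltxx.
by rewrite w0 -EFinB addrAC subrr add0r.
Qed.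

Let coded_measureT : coded_measure setT = 1%E.
Proof. by rewrite -word_cylinder0 coded_measure_word /word_weight big_nil. Qed.

HB.instance Definition _ :=
  Measure_isProbability.Build _ _ _ coded_measure coded_measureT.

Lemma exists_vector_measure :
  exists mu : probability borel_path_space R, is_vector_measure d mu.
Proof.
by exists coded_measure; apply/is_vector_measureP; exact: coded_measure_word.
Qed.

End Coding.

(** * The theorem *)

Theorem theorem5p12 (R : realType) :
  (forall d : int -> R, probability_vector d ->
     exists mu : probability borel_path_space R,
       is_vector_measure d mu /\
       forall nu : probability borel_path_space R, is_vector_measure d nu ->
         forall A : set borel_path_space, measurable A -> nu A = mu A) /\
  (forall mu : probability borel_path_space R,
     (tail_invariant mu /\ ergodic mu) <->
     (exists d : int -> R, probability_vector d /\ is_vector_measure d mu)).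
Proof.
split=> [d dP|mu].
  have [mu mud] := exists_vector_measure dP; exists mu; split=> // nu nud.
  move/is_vector_measureP in mud; move/is_vector_measureP in nud.
  apply: borel_measure_eq => [|w]; last exact: etrans (nud w) (esym (mud w)).
  by rewrite -ge0_fin_numE// fin_num_measure.
split=> [[mu_ti mu_ergodic]|[d [dP mud]]]; first exact: ergodic_vector_measure.
by split; [have [] := mud|exact: vector_measure_ergodic mud].
Qed.
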